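(* Let $m \in \mathbb{Z}^+$, let $s$ be drawn uniformly at random from $\mathcal{M}_m$, and let $\mathsf{\Phi}_m = \Phi(s)$. Then \[ \mathbb{E}\{\mathsf{\Phi}_m\} = m+1 \quad\text{and}\quad \mathrm{Var}\{\mathsf{\Phi}_m\} = \frac{q-1}{q}\binom{m+1}{3}. \]
   Context: $\mathbb{F}$ is a finite field with $q$ elements. $\mathcal{M}_m$ is the set of monic polynomials in $\mathbb{F}[x]$ of degree exactly $m$. For monic $s$, $\Phi(s)$ is the number of distinct monic divisors of $s$. *)

(* Defs.v *)
From HB Require Import structures.
From mathcomp Require Import all_boot all_order all_algebra.

Set Implicit Arguments.
Unset Strict Implicit.
Unset Printing Implicit Defensive.

Import Order.TTheory GRing.Theory Num.Theory.
Local Open Scope ring_scope.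

(* [size p] is [deg p + 1], so [{poly_m.+1 F}] is the finite type of polynomials
   of degree at most [m]. *)
Definition monics (F : finFieldType) (m : nat) : {set {poly_m.+1 F}} :=
  [set p : {poly_m.+1 F} | (size p == m.+1) && (polyn p \is monic)].

(* A divisor of a nonzero [s] has size at most [size s], so for monic [s] the
   bounded-size type contains every divisor of [s] in [{poly F}]. *)
Definition num_monic_divisors (F : finFieldType) (s : {poly F}) : nat :=
  #|[set d : {poly_(size s) F} | (polyn d \is monic) && (polyn d %| s)]|.

(* Finite probability: [P] is a probability mass function. *)
Definition uniform_pmf (R : realFieldType) (T : finType) (A : {set T}) (x : T) : R :=
  if x \in A then #|A|%:R^-1 else 0.

Definition expectation (R : realFieldType) (T : finType) (P X : T -> R) : R :=
  \sum_(x : T) P x * X x.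

Definition variance (R : realFieldType) (T : finType) (P X : T -> R) : R :=
  expectation P (fun x => (X x - expectation P X) ^+ 2).

(* Main.v *)
(* Write Phi(s) as the sum over i <= m of the number of monic divisors of degree
   i; each summand has mean 1. The second moment counts triples (d, e, s) with
   d | s and e | s. Writing d = g a, e = g b with g monic and a, b coprime, both
   divide s iff g a b does, and a proportion 1/q of the pairs (a, b) of fixed
   positive degrees is not coprime. Hence the numbers of divisors of degrees i and j have
   covariance (q - 1) / q * min(i, j, m - i, m - j), and these minima add up to
   the binomial coefficient (m + 1 choose 3), by removing the boundary of the
   square [0, m]^2. *)
Require Import Defs.
From HB Require Import structures.
From mathcomp Require Import all_boot all_order all_algebra.
From mathcomp Require Import ring zify.
Import Order.TTheory GRing.Theory Num.Theory.
Local Open Scope ring_scope.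
Set Implicit Arguments.
Unset Strict Implicit.
Unset Printing Implicit Defensive.

(** * Monic polynomials of a fixed degree, and splitting sums by degree *)

(** The lists for all degrees share the type [{poly F}], so products and quotients can pass between
    them, which the types [{poly_n F}] would obstruct. The lower part [r] is free, hence [q ^ n]
    entries. *)
Definition monic_seq (F : finFieldType) (n : nat) : seq {poly F} :=
  [seq 'X^n + polyn r | r : {poly_n F}].

Section MonicSums.
Variable F : finFieldType.
Implicit Types (d e g a b p s : {poly F}) (i j k m n : nat).
Local Notation M := (monic_seq F).
Local Notation q := #|F|.

Lemma monic_seq_uniq n : uniq (M n).
Proof.
by rewrite map_inj_uniq ?enum_uniq // => r1 r2 /addrI /val_inj.
Qed.

Lemma mem_monic_seq n p : (p \in M n) = (p \is monic) && (size p == n.+1).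
Proof.
apply/mapP/andP => [[r _ ->]|[p_monic /eqP size_p]].
  have r_lt : (size (polyn r) < size ('X^n : {poly F}))%N.
    by rewrite size_polyXn ltnS size_npoly.
  by rewrite monicE lead_coefDl // lead_coefXn size_polyDl // size_polyXn.
have p_top : p`_n = 1 by move/eqP: p_monic; rewrite lead_coefE size_p.
have r_size : (size (p - 'X^n)%R <= n)%N.
  apply/leq_sizeP => l; rewrite leq_eqVlt coefB coefXn => /predU1P[<-|n_lt].
    by rewrite p_top eqxx subrr.
  by rewrite nth_default ?size_p // gtn_eqF // subrr.
by exists (NPoly r_size); rewrite ?mem_enum //= addrC subrK.
Qed.

Lemma monic_seqP n p : reflect (p \is monic /\ size p = n.+1) (p \in M n).
Proof.
by rewrite mem_monic_seq; apply: (iffP andP) => -[-> /eqP].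
Qed.

Lemma size_monic_seq n : size (M n) = (q ^ n)%N.
Proof. by rewrite size_image card_npoly. Qed.

Lemma sum_monic_degree n i (H : {poly F} -> nat) : (i < n)%N ->
  (\sum_(p : {poly_n F} | (polyn p \is monic) && (size p == i.+1)) H p
   = \sum_(d <- M i) H d)%N.
Proof.
move=> lt_in; rewrite big_mkcond /= -big_enum /=.
rewrite -big_mkcond -(big_map (@polyn _ _) (fun p => (p \is monic) && (size p == i.+1)) H).
rewrite -big_filter; apply/perm_big/uniq_perm; rewrite ?monic_seq_uniq //.
  by rewrite filter_uniq // map_inj_uniq ?enum_uniq //; apply: val_inj.
move=> p; rewrite mem_filter mem_monic_seq andb_idr // => /andP[_ /eqP size_p].
have p_size : (size p <= n)%N by rewrite size_p.
by apply/mapP; exists (NPoly p_size); rewrite ?mem_enum.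
Qed.

Lemma sum_monic_npoly n (H : {poly F} -> nat) :
  (\sum_(p : {poly_n F} | polyn p \is monic) H p
   = \sum_(i < n) \sum_(d <- M i) H d)%N.
Proof.
under [RHS]eq_bigr => i _ do rewrite -(sum_monic_degree _ (ltn_ord i)).
under [RHS]eq_bigr => i _ do rewrite big_mkcondr /=.
rewrite exchange_big /=; apply: eq_bigr => p p_monic.
have size_gt0 : (0 < size p)%N by rewrite size_poly_gt0 monic_neq0.
have deg_lt : ((size p).-1 < n)%N by rewrite prednK // size_npoly.
rewrite (bigD1 (Ordinal deg_lt)) //= prednK // eqxx big1 ?addn0 // => i.
by case: (size p =P i.+1) => // size_p /eqP[]; apply: val_inj; rewrite /= size_p.
Qed.

Lemma num_monic_divisorsE m s : s \in M m ->
  num_monic_divisors s = (\sum_(i < m.+1) \sum_(d <- M i) (d %| s)%R)%N.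
Proof.
case/monic_seqP=> _ size_s.
rewrite /num_monic_divisors size_s cardsE -sum1_card.
by rewrite -(sum_monic_npoly m.+1 (fun d => d %| s)) big_mkcondr.
Qed.

(** * Multiples of a monic polynomial *)

(** Multiplication by [g] is injective, and the cofactor of [g] in a monic multiple is again monic,
    of degree [i - k]. *)
Lemma sum_dvd k i g (H : {poly F} -> nat) : g \in M k -> (k <= i)%N ->
  (\sum_(d <- M i | (g %| d)%R) H d = \sum_(a <- M (i - k)) H (g * a)%R)%N.
Proof.
case/monic_seqP=> g_monic size_g le_ki.
rewrite -(big_map [eta *%R g] xpredT H) -big_filter.
apply/perm_big/uniq_perm; rewrite ?filter_uniq ?monic_seq_uniq //.
  by rewrite map_inj_uniq ?monic_seq_uniq //; apply/mulfI/monic_neq0.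
move=> d; rewrite mem_filter mem_monic_seq.
have size_gM a : a != 0 -> size (g * a)%R = (k + size a)%N.
  by move=> a_neq0; rewrite size_monicM // size_g.
apply/and3P/mapP => [[/dvdpP[a ->] ] | [a /monic_seqP[a_monic size_a] ->]].
  rewrite mulrC monicMl // => a_monic.
  rewrite size_gM ?monic_neq0 // => /eqP size_a.
  by exists a => //; apply/monic_seqP; split=> //; lia.
rewrite dvdp_mulr // monicMl // size_gM ?monic_neq0 //.
by split=> //; apply/eqP; lia.
Qed.

Lemma dvdp_monic_seq k i g d : g \in M k -> d \in M i -> g %| d -> (k <= i)%N.
Proof.
case/monic_seqP=> _ size_g /monic_seqP[d_monic size_d].
by move/(dvdp_leq (monic_neq0 d_monic)); rewrite size_g size_d.
Qed.

Lemma mulp_monic_seq i j a b : a \in M i -> b \in M j -> a * b \in M (i + j).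
Proof.
case/monic_seqP=> a_monic size_a /monic_seqP[b_monic size_b].
apply/monic_seqP; rewrite monicMl // size_monicM ?monic_neq0 //.
by rewrite size_a size_b addSn addnS.
Qed.

(** The multiples of [g] correspond to their cofactors. The case split matters: for [m < k]
    truncated subtraction would give 1 instead of 0. *)
Lemma count_dvd k m g : g \in M k ->
  (\sum_(s <- M m) (g %| s)%R = if k <= m then q ^ (m - k) else 0)%N.
Proof.
move=> g_in; case: leqP => [le_km|lt_mk].
  transitivity (\sum_(s <- M m | (g %| s)%R) 1)%N.
    by rewrite [RHS]big_mkcond; apply: eq_bigr => s _; case: (g %| s).
  by rewrite (sum_dvd _ g_in) // sum1_size size_monic_seq.
rewrite big_seq big1 // => s s_in.
by case: (boolP (g %| s)) => // /(dvdp_monic_seq g_in s_in); rewrite leqNgt lt_mk.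
Qed.

(** * Sorting pairs by their greatest common divisor *)

(** [gcdp] is determined only up to a unit, and exactly one associate, [g0], is monic. This
    expresses 1 as a sum of indicators, to be inserted into sums over pairs. *)
Lemma sum_gcd i j d e : d \in M i -> e \in M j ->
  (\sum_(k < (minn i j).+1) \sum_(g <- M k) (gcdp d e %= g)%R = 1)%N.
Proof.
move=> d_in e_in; have [d_monic _] := monic_seqP _ _ d_in.
have gcd_neq0 : gcdp d e != 0 by rewrite gcdp_eq0 negb_and monic_neq0.
pose g0 := (lead_coef (gcdp d e))^-1 *: gcdp d e.
have lc_neq0 : lead_coef (gcdp d e) != 0 by rewrite lead_coef_eq0.
have g0_eqp : gcdp d e %= g0 by rewrite eqp_sym eqp_scale ?invr_eq0.
have g0_monic : g0 \is monic by rewrite monicE lead_coefZ mulVf.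
have size_gt0 : (0 < size g0)%N by rewrite size_poly_gt0 monic_neq0.
have g0_in : g0 \in M (size g0).-1.
  by apply/monic_seqP; rewrite prednK.
have deg_lt : ((size g0).-1 < (minn i j).+1)%N.
  rewrite ltnS leq_min (dvdp_monic_seq g0_in d_in) ?(dvdp_monic_seq g0_in e_in) //;
  by rewrite -(eqp_dvdl _ g0_eqp) (dvdp_gcdl, dvdp_gcdr).
have eqp_g0 k g : g \in M k -> (gcdp d e %= g) = (g0 == g).
  by case/monic_seqP=> g_monic _; rewrite (eqp_ltrans g0_eqp) eqp_monic.
rewrite (bigD1 (Ordinal deg_lt)) //= [X in (_ + X)%N]big1.
  rewrite addn0 (bigD1_seq g0) ?monic_seq_uniq //= g0_eqp big_seq_cond big1 //.
  by move=> g /andP[/eqp_g0->]; rewrite eq_sym => /negbTE->.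
move=> k; apply: contra_neq_eq => sum_neq0; apply: val_inj => /=.
move: sum_neq0; rewrite sum_nat_seq_neq0 => /hasP[g g_in].
rewrite eqb0 negbK (eqp_g0 _ _ g_in) => /eqP g0E.
by case/monic_seqP: g_in => _ size_g; rewrite g0E size_g.
Qed.

(** Each pair is [(g * a, g * b)] for a unique monic gcd [g] and unique coprime monic [a], [b]. *)
Lemma sum_pairs_gcd i j (H : {poly F} -> {poly F} -> nat) :
  (\sum_(d <- M i) \sum_(e <- M j) H d e =
   \sum_(k < (minn i j).+1) \sum_(g <- M k)
     \sum_(a <- M (i - k)) \sum_(b <- M (j - k) | coprimep a b)
       H (g * a)%R (g * b)%R)%N.
Proof.
transitivity (\sum_(d <- M i) \sum_(e <- M j)
    \sum_(k < (minn i j).+1) \sum_(g <- M k) (gcdp d e %= g)%R * H d e)%N.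
  apply: eq_big_seq => d d_in; apply: eq_big_seq => e e_in.
  under eq_bigr => k _ do rewrite -big_distrl /=.
  by rewrite -big_distrl /= (sum_gcd d_in e_in) mul1n.
under eq_bigr => d _ do rewrite exchange_big /=.
rewrite exchange_big /=; apply: eq_bigr => k _.
under eq_bigr => d _ do rewrite exchange_big /=.
rewrite exchange_big /=; apply: eq_big_seq => g g_in.
have [le_ki le_kj] : (k <= i /\ k <= j)%N.
  by apply/andP; rewrite -leq_min -ltnS ltn_ord.
have g_neq0 : g != 0 by case/monic_seqP: g_in => /monic_neq0.
(* The indicator vanishes unless [g] divides both [d] and [e], so only multiples of [g] remain and
   [sum_dvd] applies twice. *)
transitivity (\sum_(d <- M i | (g %| d)%R) \sum_(e <- M j | (g %| e)%R)
    (gcdp d e %= g)%R * H d e)%N.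
  rewrite [RHS]big_mkcond; apply: eq_bigr => d _.
  transitivity (\sum_(e <- M j) if (g %| d)%R && (g %| e)%R then
      (gcdp d e %= g)%R * H d e else 0)%N.
    apply: eq_bigr => e _; case: ifPn => //; rewrite -dvdp_gcd.
    by case: (boolP (_ %= g)) => // /eqp_dvdr ->; rewrite dvdpp.
  by case: (g %| d) => /=; rewrite -?big_mkcond // big1.
rewrite (sum_dvd _ g_in le_ki); apply: eq_bigr => a _.
rewrite (sum_dvd _ g_in le_kj) [RHS]big_mkcond /=; apply: eq_bigr => b _.
rewrite -(eqp_ltrans (mulp_gcdr _ _ _)) -{2}[g]mulr1 eqp_mul2l // gcdp_eqp1.
by case: ifP; rewrite (mul1n, mul0n).
Qed.


(** * Counting coprime pairs *)

Lemma card_field_gt0 : (0 < q)%N.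
Proof. by rewrite -cardsT; apply/card_gt0P; exists (0 : F); rewrite inE. Qed.

Definition num_coprime i j : nat :=
  (\sum_(a <- M i) \sum_(b <- M j | coprimep a b) 1)%N.

(** Both sides count all pairs of monic polynomials of degrees [i] and [j]; on the left they are
    grouped by the degree [k] of the gcd, itself one of [q ^ k] polynomials. *)
Lemma sum_num_coprime i j :
  (\sum_(k < (minn i j).+1) q ^ k * num_coprime (i - k) (j - k)
   = q ^ (i + j))%N.
Proof.
transitivity (\sum_(d <- M i) \sum_(e <- M j) 1)%N; last first.
  rewrite sum1_size size_monic_seq big_const_seq count_predT iter_addn_0.
  by rewrite size_monic_seq expnD mulnC.
rewrite (sum_pairs_gcd i j (fun _ _ => 1%N)); apply: eq_bigr => k _.
by rewrite big_const_seq count_predT iter_addn_0 size_monic_seq mulnC.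
Qed.

Lemma num_coprime_min0 i j : minn i j = 0%N -> num_coprime i j = (q ^ (i + j))%N.
Proof.
by rewrite -sum_num_coprime => ->; rewrite big_ord1 !subn0 mul1n.
Qed.

(** In [sum_num_coprime] for [i.+1], [j.+1], the terms with [k > 0] are [q] times the whole sum for
    [i], [j]. The term [k = 0] is thus [q ^ (i + j).+2 - q ^ (i + j).+1]. *)
Lemma num_coprimeSS i j :
  num_coprime i.+1 j.+1 = (q ^ (i + j).+1 * (q - 1))%N.
Proof.
have := sum_num_coprime i.+1 j.+1.
rewrite minnSS big_ord_recl mul1n !subn0 /=.
under eq_bigr => k _ do rewrite /bump add1n !subSS expnS -mulnA.
rewrite -big_distrr /= sum_num_coprime addSn addnS mulnBr muln1 -expnS -expnSr.
by move=> <-; rewrite addnK.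
Qed.

(** * Common multiples of two divisors *)

Lemma dvdp_mul_coprime g a b s : g != 0 -> coprimep a b ->
  (g * (a * b) %| s) = (g * a %| s) && (g * b %| s).
Proof.
move=> g_neq0 co_ab; case: (boolP (g %| s)) => [/dvdpP[u ->]|gNs].
  by rewrite [u * g]mulrC !dvdp_mul2l // Gauss_dvdp.
have gcNs c : (g * c %| s) = false.
  by apply: contraNF gNs; apply: dvdp_trans; apply: dvdp_mulr.
by rewrite !gcNs.
Qed.

Lemma sum_ord_geq n t c :
  (\sum_(k < n) (if t <= k then c else 0) = c * (n - t))%N.
Proof.
elim: n => [|n IHn]; first by rewrite big_ord0 sub0n muln0.
rewrite big_ord_recr /= IHn; case: leqP => [le_tn|lt_nt].
  by rewrite subSn // mulnS addnC.
have -> : (n - t = 0)%N by lia.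
have -> : (n.+1 - t = 0)%N by lia.
by rewrite !muln0.
Qed.

(** After division by [q ^ m], the first term is the product of the two means and the second is the
    covariance. A pair whose gcd has degree [k] has an lcm of degree [i + j - k], which has
    multiples of degree [m] exactly when [i + j - m <= k]. *)
Lemma sum_common_multiples i j m : (0 < m)%N -> (i <= m)%N -> (j <= m)%N ->
  (\sum_(d <- M i) \sum_(e <- M j) \sum_(s <- M m) (d %| s)%R * (e %| s)%R
   = q ^ m + q ^ m.-1 * (q - 1) * minn (minn i j) (m - maxn i j))%N.
Proof.
move=> m_gt0 le_im le_jm.
rewrite (sum_pairs_gcd i j (fun d e => \sum_(s <- M m) (d %| s)%R * (e %| s)%R))%N.
have count_lcm (k : 'I_(minn i j).+1) g a b : g \in M k -> a \in M (i - k) ->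
    b \in M (j - k) -> coprimep a b ->
    (\sum_(s <- M m) (g * a %| s)%R * (g * b %| s)%R
     = if i + j - m <= k then q ^ (m - (i + j - k)) else 0)%N.
  move=> g_in a_in b_in co_ab.
  have lt_k := ltn_ord k.
  have -> : (i + j - m <= k = (k + ((i - k) + (j - k)) <= m))%N by lia.
  have -> : (i + j - k = k + ((i - k) + (j - k)))%N by lia.
  rewrite -(count_dvd _ (mulp_monic_seq g_in (mulp_monic_seq a_in b_in))).
  apply: eq_bigr => s _; rewrite mulnb; congr (nat_of_bool _).
  have g_neq0 : g != 0 by case/monic_seqP: g_in => /monic_neq0.
  by rewrite dvdp_mul_coprime.
transitivity (\sum_(k < (minn i j).+1)
    if i + j - m <= k then
      q ^ k * num_coprime (i - k) (j - k) * q ^ (m - (i + j - k)) else 0)%N.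
  apply: eq_bigr => k _; set X := (q ^ (m - _))%N.
  transitivity (\sum_(g <- M k) \sum_(a <- M (i - k))
      \sum_(b <- M (j - k) | coprimep a b) if i + j - m <= k then X else 0)%N.
    apply: eq_big_seq => g g_in; apply: eq_big_seq => a a_in.
    rewrite big_seq_cond [RHS]big_seq_cond; apply: eq_bigr => b /andP[b_in co_ab].
    exact: count_lcm.
  rewrite big_const_seq count_predT iter_addn_0 size_monic_seq mulnC -mulnA.
  case: ifP => _; last first.
    by rewrite big1 ?muln0 // => a _; rewrite big1.
  congr (_ * _)%N; rewrite big_distrl; apply: eq_bigr => a _.
  by rewrite big_distrl /=; under [RHS]eq_bigr => b _ do rewrite mul1n.
(* At [k = minn i j] one cofactor has degree 0, so every pair is coprime; this index alone yields
   [q ^ m]. *)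
rewrite big_ord_recr /= ifT; last by lia.
rewrite num_coprime_min0; last by lia.
rewrite -!expnD addnC; congr (q ^ _ + _)%N; first by lia.
(* The minimum is the number of remaining admissible [k]. For each of them both cofactors have
   positive degree, and the powers of [q] combine to [q ^ m.-1 * (q - 1)], independently of [k]. *)
have -> : (minn (minn i j) (m - maxn i j) = minn i j - (i + j - m))%N by lia.
rewrite -sum_ord_geq; apply: eq_bigr => k _; case: ifP => // le_k.
have lt_k := ltn_ord k.
have -> : (i - k = (i - k).-1.+1)%N by lia.
have -> : (j - k = (j - k).-1.+1)%N by lia.
rewrite num_coprimeSS mulnA mulnAC -!expnD; congr (q ^ _ * _)%N; lia.
Qed.

End MonicSums.

(** * Summing the distances to the boundary of a square *)

(** Induction in steps of two. On the square of side [m.+2] the boundary contributes 0, and each of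
    the [m.+1 ^ 2] interior points has a value one larger than in the square of side [m]. *)
Lemma sum_min_distances m :
  (\sum_(i < m.+1) \sum_(j < m.+1) minn (minn i j) (m - maxn i j)
   = 'C(m.+1, 3))%N.
Proof.
(* Consecutive triangular numbers add up to a square; by two Pascal steps this is the increment from
   ['C(m.+1, 3)] to ['C(m.+3, 3)]. *)
have sum_bin2 n : ('C(n.+1, 2) + 'C(n.+2, 2) = n.+1 ^ 2)%N.
  elim: n => [|n IHn] //.
  have bin2S k : ('C(k.+1, 2) = 'C(k, 2) + k)%N by rewrite binS bin1.
  by have := bin2S n.+1; have := bin2S n.+2; move: IHn; rewrite -!mulnn; lia.
elim/ltn_ind: m => -[|[|m]] IHm.
- by rewrite !big_ord1.
- by rewrite !big_ord_recl !big_ord0.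
rewrite big_ord_recl big1 => [|j _]; last by rewrite /= !min0n.
rewrite add0n big_ord_recr /= [X in (_ + X)%N]big1 => [|j _]; last first.
  by rewrite /bump; lia.
rewrite addn0.
transitivity (\sum_(i < m.+1) \sum_(j < m.+1) (1 + minn (minn i j) (m - maxn i j)))%N.
  apply: eq_bigr => i _; rewrite [LHS]big_ord_recl [X in (_ + X)%N]big_ord_recr /=.
  rewrite -[RHS]add0n -[X in _ = (_ + X)%N]addn0; congr (_ + (_ + _))%N.
  - by rewrite /bump; lia.
  - by apply: eq_bigr => j _; have := ltn_ord i; have := ltn_ord j; rewrite /bump; lia.
  - by have := ltn_ord i; rewrite /bump; lia.
under eq_bigr => i _ do rewrite big_split /= sum1_card card_ord.
rewrite big_split /= IHm // sum_nat_const card_ord mulnn.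
by rewrite (binS m.+2) (binS m.+1 2) -sum_bin2; lia.
Qed.

(** * Moments under the uniform distribution *)

Lemma varianceE (R : realFieldType) (T : finType) (P X : T -> R) :
  \sum_x P x = 1 ->
  variance P X = expectation P (fun x => X x ^+ 2) - expectation P X ^+ 2.
Proof.
move=> P1; rewrite /variance; set mu := expectation P X.
have -> : expectation P (fun x => (X x - mu) ^+ 2)
    = expectation P (fun x => X x ^+ 2) - mu *+ 2 * expectation P X
      + mu ^+ 2 * \sum_x P x.
  rewrite /expectation !big_distrr /= -sumrB -big_split /=.
  by apply: eq_bigr => x _; ring.
by rewrite P1 -/mu; ring.
Qed.

Lemma sum_monics (F : finFieldType) m (G : {poly F} -> nat) :
  (\sum_(s in monics F m) G s = \sum_(s <- monic_seq F m) G s)%N.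
Proof.
rewrite -(sum_monic_degree G (ltnSn m)); apply: eq_bigl => s.
by rewrite inE andbC.
Qed.

(** With [G] valued in [nat], moments reduce to the counting sums above and are cast to [R] only
    once. *)
Lemma expectation_monics (R : realFieldType) (F : finFieldType) m
    (G : {poly F} -> nat) :
  expectation (uniform_pmf R (monics F m)) (fun s => (G s)%:R)
  = (\sum_(s <- monic_seq F m) G s)%:R / #|F|%:R ^+ m.
Proof.
have card_monics : #|monics F m| = (#|F| ^ m)%N.
  by rewrite -sum1_card (sum_monics m (fun=> 1%N)) sum1_size size_monic_seq.
rewrite -sum_monics natr_sum mulr_suml /expectation [RHS]big_mkcond /=.
apply: eq_bigr => s _; rewrite /uniform_pmf card_monics natrX.
by case: ifP => _; [exact: mulrC | exact: mul0r].
Qed.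

Theorem theorem4 (R : realFieldType) (F : finFieldType) (m : nat) (hm : (0 < m)%N) :
  let q : R := #|F|%:R in
  let P : {poly_m.+1 F} -> R := uniform_pmf R (monics F m) in
  let Phi : {poly_m.+1 F} -> R := fun s => (num_monic_divisors s)%:R in
  expectation P Phi = m.+1%:R /\
  variance P Phi = (q - 1) / q * 'C(m.+1, 3)%:R.
Proof.
move=> q P Phi.
have q_gt0 : 0 < q by rewrite ltr0n card_field_gt0.
have qX_neq0 n : q ^+ n != 0 by rewrite expf_neq0 ?gt_eqF.
have P1 : \sum_s P s = 1.
  transitivity (expectation P (fun=> 1%:R)).
    by apply: eq_bigr => s _; rewrite mulr1.
  rewrite (expectation_monics R m (fun=> 1%N)) sum1_size size_monic_seq natrX.
  exact: divff.
have mean : expectation P Phi = m.+1%:R.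
  rewrite expectation_monics (eq_big_seq _ (@num_monic_divisorsE _ m)).
  rewrite exchange_big /= (eq_bigr (fun=> #|F| ^ m)%N) => [|i _].
    by rewrite sum_nat_const card_ord natrM natrX mulfK.
  (* Each of the [q ^ i] candidates [d] has [q ^ (m - i)] multiples, so every degree contributes
     [q ^ m], that is, mean 1. *)
  rewrite exchange_big /= (eq_big_seq (fun=> #|F| ^ (m - i))%N) => [|d d_in].
    rewrite big_const_seq count_predT iter_addn_0 size_monic_seq -expnD.
    by rewrite subnK // -ltnS ltn_ord.
  by rewrite (count_dvd m d_in) -ltnS ltn_ord.
split=> //; rewrite varianceE // mean.
have -> : expectation P (fun s => Phi s ^+ 2)
    = expectation P (fun s => (num_monic_divisors s ^ 2)%:R).
  by apply: eq_bigr => s _; rewrite natrX.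
rewrite (expectation_monics R m (fun s => num_monic_divisors s ^ 2)%N).
have -> : (\sum_(s <- monic_seq F m) num_monic_divisors s ^ 2
    = \sum_(i < m.+1) \sum_(j < m.+1)
        (#|F| ^ m + #|F| ^ m.-1 * (#|F| - 1) * minn (minn i j) (m - maxn i j)))%N.
  (* The square of the divisor count runs over pairs of divisors; moving the sum over [s] innermost
     gives [sum_common_multiples]. *)
  transitivity (\sum_(s <- monic_seq F m) \sum_(i < m.+1) \sum_(j < m.+1)
      \sum_(d <- monic_seq F i) \sum_(e <- monic_seq F j) (d %| s)%R * (e %| s)%R)%N.
    apply: eq_big_seq => s s_in; rewrite (num_monic_divisorsE s_in) -mulnn.
    rewrite big_distrlr /=; apply: eq_bigr => i _; apply: eq_bigr => j _.
    exact: big_distrlr.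
  rewrite exchange_big; apply: eq_bigr => i _.
  rewrite exchange_big; apply: eq_bigr => j _.
  have le_im : (i <= m)%N by rewrite -ltnS.
  have le_jm : (j <= m)%N by rewrite -ltnS.
  rewrite -(sum_common_multiples _ hm le_im le_jm) exchange_big.
  by apply: eq_bigr => d _; rewrite exchange_big.
under eq_bigr => i _.
  rewrite big_split /= sum_nat_const card_ord -big_distrr /=; over.
rewrite big_split /= sum_nat_const card_ord -big_distrr /= sum_min_distances.
(* Writing [q ^+ m] as [q * q ^+ m.-1] lets [field] cancel the common power and leave [1 / q]; the
   terms [q ^ m] cancel the squared mean. *)
rewrite natrD !natrM !natrX natrB ?card_field_gt0 // -/q -[in q ^+ m](prednK hm).
rewrite -[m in X in _ / X](prednK hm) exprS.
have qm_neq0 := qX_neq0 m.-1; have q_neq0 : q != 0 by rewrite gt_eqF.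
by field; apply/andP; split.
Qed.
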